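(* Let $k\ge 1$ be an integer, let $\alpha>-1$ be real, and let $x_1$ and $x_k$ be the least and the largest zero of the Laguerre polynomial $L_k^{(\alpha)}(x)$, respectively. Put $V=\sqrt{k+\alpha+1}-\sqrt{k}$ and $U=\sqrt{k+\alpha+1}+\sqrt{k}$. (1) Let $\delta=\frac1k+\frac1{\alpha+1}$. If $\delta<\frac1{50}$, then $$x_1< V^2+\frac{9V^{4/3}}{(U^2-V^2)^{1/3}\,(2-27\,\delta^{2/3})}.$$ (2) Let $k\ge 30$. If $\alpha\le 2(3+2\sqrt3)k-1$, then $$x_k> U^2-\frac{9U^{4/3}}{2(U^2-V^2)^{1/3}},$$ and otherwise (that is, if $\alpha> 2(3+2\sqrt3)k-1$), $$x_k> U^2-\frac{9U^{4/3}}{(U^2-V^2)^{1/3}\,(2-3k^{-2/3})}.$$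
   Context: For $\alpha>-1$, the Laguerre polynomial $L_k^{(\alpha)}(x)=\sum_{i=0}^k\binom{k+\alpha}{k-i}\frac{(-x)^i}{i!}$ is the degree-$k$ polynomial orthogonal on $[0,\infty)$ with respect to the weight $x^\alpha e^{-x}$; it has $k$ simple real zeros $x_1<\dots<x_k$. *)

(* Defs.v *)
From mathcomp Require Import all_boot all_order all_algebra.
From mathcomp Require Import reals exp.

Set Implicit Arguments.
Unset Strict Implicit.
Unset Printing Implicit Defensive.

Import Order.TTheory GRing.Theory Num.Theory.
Local Open Scope ring_scope.

(* Binomial coefficient with a real upper argument:
   a (a - 1) ... (a - m + 1) / m!. *)
Definition gbinom (R : realType) (a : R) (m : nat) : R :=
  (\prod_(j < m) (a - j%:R)) / m`!%:R.

Definition laguerre (R : realType) (k : nat) (alpha : R) : {poly R} :=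
  \sum_(i < k.+1)
    (gbinom (k%:R + alpha) (k - i) / i`!%:R) *: (- 'X) ^+ i.

Definition least_root (R : realType) (p : {poly R}) (x : R) : Prop :=
  root p x /\ forall y : R, root p y -> x <= y.

Definition largest_root (R : realType) (p : {poly R}) (x : R) : Prop :=
  root p x /\ forall y : R, root p y -> y <= x.

(* Main.v *)
(* The function z = x^((alpha+1)/2) e^(-x/2) L_k(x) satisfies z'' + Q z = 0 with
   4 x^2 Q = (x - V^2)(U^2 - x) + 2(alpha + 1). If L_k has no zero on [u, u + l],
   then the integral of psi'^2 - Q psi^2 over this interval is nonnegative for every
   psi vanishing at both ends (Picone). The choice psi = x (x - u)(u + l - x) makes
   the integrand a polynomial. Put L = (W^2 / (U^2 - V^2))^(1/3), with W = V^2 or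
   U^2, and l = c L: if l is small compared with W and U^2 - V^2, the integral is
   negative as soon as c^3 > 80, and 80 < (9/2)^3. Hence an interval of length about
   (9/2) L starting at V^2, or ending at U^2, contains a zero of L_k. *)
Require Import Defs.
From mathcomp Require Import all_boot all_order all_algebra.
From mathcomp Require Import reals exp.
From mathcomp Require Import classical_sets topology normedtype derive.
From mathcomp Require Import ring lra.

Set Implicit Arguments.
Unset Strict Implicit.
Unset Printing Implicit Defensive.

Import Order.TTheory GRing.Theory Num.Theory.
Import numFieldNormedType.Exports.
Local Open Scope ring_scope.

(** * Coefficients of the Laguerre polynomial and its differential equation *)

Lemma gbinomS (R : realType) (a : R) (m : nat) :
  m.+1%:R * gbinom a m.+1 = (a - m%:R) * gbinom a m.
Proof.
rewrite /gbinom big_ord_recr /= factS natrM.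
have h2 : m`!%:R != 0 :> R by rewrite pnatr_eq0 -lt0n fact_gt0.
by field; rewrite h2 nat1r pnatr_eq0.
Qed.

Lemma coef_laguerre (R : realType) (k : nat) (alpha : R) (i : nat) :
  (laguerre k alpha)`_i =
  if (i < k.+1)%N
  then (-1) ^+ i * (gbinom (k%:R + alpha) (k - i) / i`!%:R) else 0.
Proof.
rewrite /laguerre coef_sum.
have N1 : -1 = (-1)%:P :> {poly R} by rewrite polyCN.
under eq_bigr => j _ do
  rewrite coefZ -mulN1r exprMn N1 -rmorphXn /= coefCM coefXn.
case: ltnP => ik.
  rewrite (bigD1 (Ordinal ik)) //= eqxx mulr1 big1 ?addr0 => [|j]; first by ring.
  rewrite -val_eqE /= eq_sym => /negPf ->.
  by rewrite !mulr0.
rewrite big1 // => j _.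
by rewrite gtn_eqF ?mulr0 // (leq_trans (ltn_ord j)).
Qed.

Lemma laguerre_ode (R : realType) (k : nat) (alpha x : R) :
  let f := laguerre k alpha in
  x * f^`()^`().[x] + (alpha + 1 - x) * f^`().[x] + k%:R * f.[x] = 0.
Proof.
move=> f.
suff /(congr1 (horner^~ x)) :
    f^`()^`() * 'X + (alpha + 1)%:P * f^`() - f^`() * 'X + k%:R%:P * f = 0.
  by rewrite !hornerE => <-; ring.
apply/polyP => i.
(* Coefficientwise the equation is this two-term recurrence. For [i < k] it is [gbinomS] at
   [m = k - i - 1]; at [i = k] the factor [k - i] vanishes, and beyond that both coefficients are
   0. *)
have cS : i.+1%:R * (i.+1%:R + alpha) * f`_i.+1 = - (k%:R - i%:R) * f`_i.
  rewrite !coef_laguerre !ltnS.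
  case: (ltngtP i k) => [ik|ik|->]; rewrite ?ltnn ?mulr0 ?subrr ?oppr0 ?mul0r //.
  have := gbinomS (k%:R + alpha) (k - i.+1).
  rewrite subnSK // factS natrM (natrB _ ik) (natrB _ (ltnW ik)) exprS.
  have h2 : i`!%:R != 0 :> R by rewrite pnatr_eq0 -lt0n fact_gt0.
  move=> e.
  have -> : - (k%:R - i%:R) * ((-1) ^+ i * (gbinom (k%:R + alpha) (k - i) / i`!%:R)) =
    - ((k%:R - i%:R) * gbinom (k%:R + alpha) (k - i)) * ((-1) ^+ i / i`!%:R) by ring.
  by rewrite e; field; rewrite h2 nat1r pnatr_eq0.
have coefd (g : {poly R}) j : g^`()`_j = j.+1%:R * g`_j.+1.
  by rewrite coef_deriv mulr_natl.
rewrite !(coefD, coefN, coefCM, coefMX, coef0).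
move: cS; clearbody f; case: i => [|i] /=; rewrite !coefd.
  by move: f`_0 f`_1 => c0 c1 cS; lra.
rewrite -(natr1 i.+1).
by move: f`_i.+1 f`_i.+2 i.+1%:R => c1 c2 j cS; lra.
Qed.

(** * Picone's inequality on an interval without zeros *)

(** The last hypothesis says that [H = w f'/f + p] has nonpositive derivative. As [w] vanishes at
    both ends, the mean value theorem for [H] compares the end values of [p] alone. *)
Lemma logderiv_decreasing (R : realType) (f w p : {poly R}) (u v : R) :
  u < v ->
  (forall x, u <= x <= v -> ~~ root f x) ->
  w.[u] = 0 -> w.[v] = 0 ->
  (forall x, u < x < v ->
     w^`().[x] * (f^`().[x] / f.[x])
     + w.[x] * (f^`()^`().[x] / f.[x] - (f^`().[x] / f.[x]) ^+ 2)
     + p^`().[x] <= 0) ->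
  p.[v] <= p.[u].
Proof.
move=> uv f0 wu wv hle.
pose H x := w.[x] * (f^`().[x] * (f.[x])^-1) + p.[x].
pose dH x := w^`().[x] * (f^`().[x] / f.[x])
     + w.[x] * (f^`()^`().[x] / f.[x] - (f^`().[x] / f.[x]) ^+ 2) + p^`().[x].
have HD x : u <= x <= v -> is_derive x 1 H (dH x).
  move=> /f0 fx; have {}fx : f.[x] != 0 by [].
  have i1 := is_derive_poly w x.
  have i2 := is_derive_poly f^`() x.
  have i3 := is_derive_poly f x.
  have i4 := is_derive_poly p x.
  have i5 : is_derive x 1 (fun t => (f.[t])^-1) (- f.[x] ^- 2 * f^`().[x]).
    have [df <-] := i3.
    by apply: DeriveDef; [exact: derivableV | rewrite deriveV].
  have : is_derive x 1 H _ := is_deriveD (is_deriveM i1 (is_deriveM i2 i5)) i4.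
  move/is_derive_eq; apply.
  rewrite /dH /= /GRing.scale /=.
  rewrite -[X in X * w^`().[x]]/(f^`().[x] / f.[x]); field; exact: fx.
have [||c cuv] := @MVT R H dH u v uv.
- by move=> x; rewrite in_itv /= => /andP[ux xv]; apply: HD; rewrite !ltW.
- apply: derivable_within_continuous => x; rewrite in_itv /= => xuv.
  by have [] := HD x xuv.
rewrite /H wu wv !mul0r !add0r => e.
rewrite -subr_le0 e pmulr_lle0 ?subr_gt0 //.
by apply: hle; move: cuv; rewrite in_itv.
Qed.

(** Here [q x] is [4 x^2 Q] and [q'] is its derivative at [u]. With [psi = x chi], the two sides are
    [4 / l^3] times the integrals of [q chi^2 / 4] and [x^2 chi'^2]. *)
Lemma root_free_interval (R : realType) (k : nat) (alpha u l : R) :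
  let f := laguerre k alpha in
  let a := alpha + 1 in
  let q x := 4 * k%:R * x - (x - a) ^+ 2 + 2 * a in
  let q' := 4 * k%:R + 2 * a - 2 * u in
  0 < u -> 0 < l ->
  (forall x, u <= x <= u + l -> ~~ root f x) ->
  q u * l ^+ 2 / 30 + q' * l ^+ 3 / 60 - l ^+ 4 / 105
    <= 4 * (u ^+ 2 / 3 + u * l / 3 + 2 * l ^+ 2 / 15).
Proof.
move=> f a q q' u0 l0 f0.
(* d1, ..., d7 are the coefficients of x^2 chi'^2 - q(x) chi^2 / 4 in powers of
   y = x - u, and I is its antiderivative. *)
pose y : {poly R} := 'X - u%:P.
pose chi := y * (l%:P - y).
pose q0 := q u.
pose d1 := u ^+ 2 * l ^+ 2.
pose d2 := 2 * u * l ^+ 2 - 4 * l * u ^+ 2.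
pose d3 := l ^+ 2 - 8 * u * l + 4 * u ^+ 2 - q0 * l ^+ 2 / 4.
pose d4 := - 4 * l + 8 * u + (2 * l * q0 - q' * l ^+ 2) / 4.
pose d5 := 4 - (q0 - 2 * l * q' - l ^+ 2) / 4.
pose d6 := - (q' + 2 * l) / 4.
pose d7 : R := 1 / 4.
pose I := d1%:P * y + (d2 / 2)%:P * y ^+ 2 + (d3 / 3)%:P * y ^+ 3
  + (d4 / 4)%:P * y ^+ 4 + (d5 / 5)%:P * y ^+ 5 + (d6 / 6)%:P * y ^+ 6
  + (d7 / 7)%:P * y ^+ 7.
pose w := ('X * chi) ^+ 2.
(* The first term turns [f'/f] into [z'/z]: [w (a / (2x) - 1/2) = x chi^2 (a - x) / 2]. The other
   two form an antiderivative of [Q psi^2 - psi'^2], because [psi'^2 = (x chi^2)' + x^2 chi'^2]. *)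
pose p := 'X * chi ^+ 2 * (a%:P - 'X) * (1/2)%:P - 'X * chi ^+ 2 - I.
have yE x : y.[x] = x - u by rewrite !hornerE.
have chiE x : chi.[x] = (x - u) * (l - (x - u)) by rewrite !hornerE.
have dy : y^`() = 1 by rewrite derivB derivX derivC subr0.
have dyn n x : (y ^+ n.+1)^`().[x] = n.+1%:R * (x - u) ^+ n.
  by rewrite deriv_exp dy mul1r -mulr_natl hornerM -polyC_natr hornerC horner_exp yE.
have dchi x : chi^`().[x] = l - 2 * (x - u).
  by rewrite derivM dy derivB derivC dy !hornerE; ring.
clearbody chi; clearbody y.
have dI x : I^`().[x] = d1 + d2 * (x - u) + d3 * (x - u) ^+ 2
  + d4 * (x - u) ^+ 3 + d5 * (x - u) ^+ 4 + d6 * (x - u) ^+ 5 + d7 * (x - u) ^+ 6.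
  rewrite /I !derivD !deriv_mulC dy !hornerD !hornerM !hornerC !dyn.
  by field.
have dw x : w^`().[x] = 2 * x * chi.[x] * (chi.[x] + x * chi^`().[x]).
  rewrite /w deriv_exp derivM derivX /= -mulr_natl -polyC_natr.
  rewrite !(hornerD, hornerM, hornerX, hornerC, horner_exp).
  by ring.
have dp x : p^`().[x] = chi.[x] ^+ 2 * (a - x) / 2 + x * chi.[x] * chi^`().[x] * (a - x)
   - x * chi.[x] ^+ 2 / 2 - chi.[x] ^+ 2 - 2 * x * chi.[x] * chi^`().[x] - I^`().[x].
  rewrite /p !(derivD, derivN, derivM, derivX, derivC, deriv_exp).
  rewrite !(hornerD, hornerN, hornerM, hornerX, hornerC, horner_exp) /=.
  by field.
have main : p.[u + l] <= p.[u].
  apply: (@logderiv_decreasing R f w) => //.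
  - by rewrite ltrDl.
  - by rewrite /w horner_exp hornerM hornerX chiE subrr !(mul0r, mulr0) expr0n.
  - rewrite /w horner_exp hornerM hornerX chiE [u + l]addrC addrK.
    by rewrite subrr !(mul0r, mulr0) expr0n.
  - move=> x /andP[ux xv].
    have fx : f.[x] != 0 by apply: f0; rewrite !ltW.
    have x0 : x != 0 by rewrite gt_eqF // (lt_trans u0).
    set t := f^`().[x] / f.[x].
    have -> : f^`()^`().[x] / f.[x] = - ((a - x) * t + k%:R) / x.
      have := laguerre_ode k alpha x; rewrite -/f -/a /t => ode.
      have -> : k%:R = - (x * f^`()^`().[x] + (a - x) * f^`().[x]) / f.[x].
        apply: (canRL (mulfK fx)); lra.
      by field; rewrite fx x0.
    have wE : w.[x] = (x * chi.[x]) ^+ 2 by rewrite /w horner_exp hornerM hornerX.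
    rewrite dw dp dI dchi wE chiE.
    set g := (x - u) * (l - (x - u)).
    set g' := l - 2 * (x - u).
    (* Picone's completed square [-(psi z'/z - psi')^2]. *)
    rewrite [leLHS](_ : _ = - (x * g * t + g * (a - x) / 2 - g - x * g') ^+ 2).
      by rewrite oppr_le0 sqr_ge0.
    rewrite /d1 /d2 /d3 /d4 /d5 /d6 /d7 /q0 /q /q' /g /g'.
    by field; exact: x0.
have pu : p.[u] = 0.
  rewrite /p /I !(hornerD, hornerN, hornerM, hornerX, hornerC, horner_exp).
  by rewrite chiE yE subrr !(mul0r, mulr0, expr0n) /=; ring.
have pv : p.[u + l] = - (d1 * l + d2 / 2 * l ^+ 2 + d3 / 3 * l ^+ 3 + d4 / 4 * l ^+ 4
    + d5 / 5 * l ^+ 5 + d6 / 6 * l ^+ 6 + d7 / 7 * l ^+ 7).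
  rewrite /p /I !(hornerD, hornerN, hornerM, hornerX, hornerC, horner_exp).
  by rewrite chiE yE [u + l]addrC addrK subrr; field.
move: main; rewrite pu pv oppr_le0.
set J := (X in 0 <= X) => J0.
rewrite -subr_ge0 -(pmulr_rge0 _ (_ : 0 < l ^+ 3 / 4)) ?divr_gt0 ?exprn_gt0 //.
rewrite [leRHS](_ : _ = J) // /J /d1 /d2 /d3 /d4 /d5 /d6 /d7 /q0.
by field.
Qed.

(** * Extreme zeros located by an inequality on the interval length *)

(** Otherwise [[V^2, V^2 + l]] has no zero. At [u = V^2] one has [q u = 2 U V] and [q' = U^2 - V^2];
    dropping the positive term with [U V] and multiplying by 3/4 contradicts the assumed
    inequality. *)
Lemma least_root_laguerre_le (R : realType) (k : nat) (alpha x1 U V l : R) :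
  least_root (laguerre k alpha) x1 ->
  U * V = alpha + 1 -> U ^+ 2 + V ^+ 2 = 4 * k%:R + 2 * (alpha + 1) ->
  -1 < alpha -> 0 < l ->
  V ^+ 4 + V ^+ 2 * l + 2 / 5 * l ^+ 2
    < (U ^+ 2 - V ^+ 2) * l ^+ 3 / 80 - l ^+ 4 / 140 ->
  x1 <= V ^+ 2 + l.
Proof.
move=> [_ x1_min] UV U2V2 alpha_gt l0; apply: contraTT.
rewrite -!leNgt -ltNge => x1_gt.
have V0 : V != 0 by apply/eqP => V0; move: UV; rewrite V0; lra.
have V2 : 0 < V ^+ 2 by rewrite exprn_even_gt0.
have noroot x : V ^+ 2 <= x <= V ^+ 2 + l -> ~~ root (laguerre k alpha) x.
  by move=> /andP[_ xl]; apply/negP => /x1_min; lra.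
have := root_free_interval V2 l0 noroot.
have UV0 : 0 < U * V by rewrite UV; lra.
have kE : 4 * k%:R = U ^+ 2 + V ^+ 2 - 2 * (U * V) by rewrite UV U2V2; ring.
rewrite kE -UV.
have l2 : 0 < l ^+ 2 by rewrite exprn_gt0.
have := mulr_gt0 UV0 l2.
by lra.
Qed.

(** With [u = U^2 - l] the left side is the same as at the lower end, while the right side becomes
    [4/3 (U^4 - U^2 l + 2/5 l^2)]. Since [l < U^2], this is below [4/3 U^4]. *)
Lemma largest_root_laguerre_ge (R : realType) (k : nat) (alpha xk U V l : R) :
  largest_root (laguerre k alpha) xk ->
  U * V = alpha + 1 -> U ^+ 2 + V ^+ 2 = 4 * k%:R + 2 * (alpha + 1) ->
  -1 < alpha -> 0 < l -> l < U ^+ 2 ->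
  U ^+ 4 < (U ^+ 2 - V ^+ 2) * l ^+ 3 / 80 - l ^+ 4 / 140 ->
  U ^+ 2 - l <= xk.
Proof.
move=> [_ xk_max] UV U2V2 alpha_gt l0 lU; apply: contraTT.
rewrite -!leNgt -ltNge => xk_lt.
have u0 : 0 < U ^+ 2 - l by lra.
have noroot x : U ^+ 2 - l <= x <= U ^+ 2 - l + l -> ~~ root (laguerre k alpha) x.
  by move=> /andP[xl _]; apply/negP => /xk_max; lra.
have := root_free_interval u0 l0 noroot.
have UV0 : 0 < U * V by rewrite UV; lra.
have kE : 4 * k%:R = U ^+ 2 + V ^+ 2 - 2 * (U * V) by rewrite UV U2V2; ring.
rewrite kE -UV.
have l2 : 0 < l ^+ 2 by rewrite exprn_gt0.
have := mulr_gt0 UV0 l2.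
have : 0 < l * (U ^+ 2 - l) by rewrite mulr_gt0.
by lra.
Qed.

(** * Cube roots, rescaling and a numerical estimate *)

Lemma powR_cube (R : realType) (x y : R) : 0 <= x -> (x `^ (y / 3)) ^+ 3 = x `^ y.
Proof.
by move=> x0; rewrite -powR_mulrn ?powR_ge0 // -powRrM divfK // pnatr_eq0.
Qed.

Lemma powR_ratio_cube (R : realType) (x m : R) : 0 < x -> 0 < m ->
  (x `^ (4 / 3) / m `^ (1 / 3)) ^+ 3 = x ^+ 4 / m.
Proof.
move=> x0 m0; rewrite expr_div_n !powR_cube ?ltW // powRr1 ?ltW //.
by rewrite powR_mulrn // ltW.
Qed.

Lemma ler_cube (R : realType) (x y : R) : 0 <= x -> 0 <= y ->
  x ^+ 3 <= y ^+ 3 -> x <= y.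
Proof. by move=> x0 y0; rewrite ler_pXn2r. Qed.

(** Division by [W^2 = m L^3] makes the condition on [l = c L] dimensionless, with [e = L / W] and
    [h = L / m]; for [e = h = 0] it reads [c^3 > 80]. *)
Lemma scale_cube (R : realType) (W m L c e h : R) :
  m * L ^+ 3 = W ^+ 2 -> L = e * W -> L = h * m -> 0 < W ->
  1 + c * e + 2 / 5 * c ^+ 2 * e ^+ 2 < c ^+ 3 / 80 - c ^+ 4 * h / 140 ->
  W ^+ 2 + W * (c * L) + 2 / 5 * (c * L) ^+ 2
    < m * (c * L) ^+ 3 / 80 - (c * L) ^+ 4 / 140.
Proof.
move=> mL Le Lh W0 ineq.
have W2 : 0 < W ^+ 2 by rewrite exprn_gt0.
have -> : W ^+ 2 + W * (c * L) + 2 / 5 * (c * L) ^+ 2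
    = W ^+ 2 * (1 + c * e + 2 / 5 * c ^+ 2 * e ^+ 2) by rewrite Le; field.
have -> : m * (c * L) ^+ 3 / 80 - (c * L) ^+ 4 / 140
    = W ^+ 2 * (c ^+ 3 / 80 - c ^+ 4 * h / 140).
  have L4 : L ^+ 4 = h * m * L ^+ 3 by rewrite exprS {1}Lh.
  by rewrite -mL [(c * L) ^+ 4]exprMn L4; field.
by rewrite ltr_pM2l.
Qed.

(** The value [c^3 / 80] exceeds 1 already at [kap = 0] and then grows faster than 13 [kap], whereas
    the error terms total less than 9 [kap], by [c <= 6]. *)
Lemma small_parameter_ineq (R : realType) (kap e h c : R) :
  c = 9 / 2 + 18 * kap -> 0 < kap -> kap < 2 / 27 ->
  0 <= e <= kap -> 0 <= h <= kap / 6 ->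
  1 + c * e + 2 / 5 * c ^+ 2 * e ^+ 2 < c ^+ 3 / 80 - c ^+ 4 * h / 140.
Proof.
move=> cE k0 k1 /andP[e0 ek] /andP[h0 hk].
have c0 : 0 <= c by rewrite cE; lra.
have c6 : c <= 6 by rewrite cE; lra.
have c2 : c ^+ 2 <= 36 by nra.
have c4 : c ^+ 4 <= 1296 by rewrite (exprM c 2 2); nra.
have ce : c * e <= 6 * kap by rewrite ler_pM.
have ce2 : c ^+ 2 * e ^+ 2 <= 36 * (kap * (2 / 27)).
  rewrite ler_pM ?exprn_ge0 // expr2 ler_pM //; lra.
have ch : c ^+ 4 * h <= 1296 * (kap / 6) by rewrite ler_pM ?exprn_ge0.
have c3 : 91 + 1093 * kap <= c ^+ 3.
  have -> : c ^+ 3 = 729 / 8 + 2187 / 2 * kap + 4374 * kap ^+ 2 + 5832 * kap ^+ 3.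
    by rewrite cE; field.
  have := exprn_gt0 2 k0; have := exprn_gt0 3 k0; lra.
lra.
Qed.

(** * The explicit bounds *)

(** The quantity [kap = delta^(2/3)] controls both parameters: [e <= kap] and [h <= kap / 6]. So
    [l = c L] with [c = 9/2 + 18 kap] is long enough. *)
Lemma least_root_laguerre_lt (R : realType) (k : nat) (alpha x1 A B : R) :
  0 < B -> B < A -> B ^+ 2 = k%:R -> A ^+ 2 = k%:R + alpha + 1 ->
  let V := A - B in let U := A + B in
  let delta : R := k%:R^-1 + (alpha + 1)^-1 in
  least_root (laguerre k alpha) x1 -> delta < 1 / 50 ->
  x1 < V ^+ 2 + 9 * V `^ (4 / 3) /
         ((U ^+ 2 - V ^+ 2) `^ (1 / 3) * (2 - 27 * delta `^ (2 / 3))).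
Proof.
move=> B0 BA B2 A2 V U delta x1P delta_lt; have A0 : 0 < A by lra.
have UVE : U * V = A ^+ 2 - B ^+ 2 by rewrite /U /V; ring.
have UV : U * V = alpha + 1 by rewrite UVE A2 B2; ring.
have U2V2 : U ^+ 2 + V ^+ 2 = 4 * k%:R + 2 * (alpha + 1).
  rewrite (_ : _ + _ = 2 * (A ^+ 2 + B ^+ 2)); last by rewrite /U /V; ring.
  by rewrite A2 B2; ring.
have alpha_gt : -1 < alpha.
  have : B ^+ 2 < A ^+ 2 by rewrite ltr_pXn2r ?nnegrE //; lra.
  by rewrite A2 B2; lra.
have V0 : 0 < V by rewrite subr_gt0.
have U0 : 0 < U by rewrite addr_gt0.
have VA : V <= A by rewrite /V; lra.
have UA : U <= 2 * A by rewrite /U; lra.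
have W0 : 0 < V ^+ 2 by rewrite exprn_gt0.
set m := U ^+ 2 - V ^+ 2; have mE : m = 4 * A * B by rewrite /m /U /V; ring.
have m0 : 0 < m by rewrite mE !mulr_gt0.
have deltaE : delta = A ^+ 2 / (B ^+ 2 * (U * V)).
  rewrite /delta -B2 -UV.
  have -> : A ^+ 2 = B ^+ 2 + U * V by rewrite /U /V; ring.
  by field; rewrite !gt_eqF.
have delta0 : 0 < delta by rewrite deltaE divr_gt0 ?mulr_gt0 ?exprn_gt0.
set kap := delta `^ (2 / 3).
have kap0 : 0 < kap by rewrite powR_gt0.
have kap3 : kap ^+ 3 = delta ^+ 2 by rewrite powR_cube ?ltW // powR_mulrn ?ltW.
(* This is the positivity of [2 - 27 kap]. The threshold 1/50 lies just below [(2/27)^(3/2)], about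
   0.02016. *)
have kap_lt : kap < 2 / 27.
  rewrite ltNge; apply/negP => /(lerXn2r 3).
  rewrite !nnegrE => /(_ ltac:(lra) (ltW kap0)); rewrite kap3 => h.
  have : delta ^+ 2 <= (1 / 50) ^+ 2 by rewrite ler_pXn2r ?nnegrE //; lra.
  lra.
set L := V `^ (4 / 3) / m `^ (1 / 3).
have L0 : 0 < L by rewrite divr_gt0 ?powR_gt0.
have L3 : L ^+ 3 = V ^+ 4 / m by exact: powR_ratio_cube.
pose e := L / V ^+ 2; pose h := L / m.
have e0 : 0 <= e by rewrite divr_ge0 ?ltW.
have h0 : 0 <= h by rewrite divr_ge0 ?ltW.
have B3A3 : B ^+ 3 <= A ^+ 3 by rewrite ler_pXn2r ?nnegrE //; lra.
have ek : e <= kap.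
  apply: ler_cube => //; first lra.
  have -> : e ^+ 3 = (V ^+ 2 * m)^-1.
    by rewrite /e expr_div_n L3; field; rewrite !gt_eqF.
  rewrite kap3 deltaE mE.
  (* The first factor is at least 1 because [B <= A] and [U <= 2 A]. *)
  have -> : (A ^+ 2 / (B ^+ 2 * (U * V))) ^+ 2
      = (4 * A ^+ 5 / (B ^+ 3 * U ^+ 2)) * (V ^+ 2 * (4 * A * B))^-1.
    by field; rewrite !gt_eqF.
  apply: ler_peMl; first by rewrite ltW // invr_gt0 !mulr_gt0 ?exprn_gt0.
  rewrite ler_pdivlMr ?mulr_gt0 ?exprn_gt0 // mul1r.
  have -> : 4 * A ^+ 5 = A ^+ 3 * (2 * A) ^+ 2 by ring.
  by rewrite ler_pM ?exprn_ge0 ?ler_pXn2r ?nnegrE //; lra.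
have hk : h <= kap / 6.
  apply: ler_cube => //; first lra.
  have -> : h ^+ 3 = V ^+ 4 / m ^+ 4.
    by rewrite /h expr_div_n L3; field; rewrite !gt_eqF.
  rewrite expr_div_n kap3 deltaE mE.
  (* Here [216 = 6^3] and [256 = 4^4], so the 6 in [kap / 6] still leaves a factor below 1;
     [U V <= A^2] and [V <= A] bound the rest. *)
  have -> : V ^+ 4 / (4 * A * B) ^+ 4
      = ((U * V) ^+ 2 * V ^+ 4 / A ^+ 8) * (216 / 256)
        * ((A ^+ 2 / (B ^+ 2 * (U * V))) ^+ 2 / 6 ^+ 3).
    by field; rewrite !gt_eqF.
  apply: ler_piMl; first by rewrite divr_ge0 ?exprn_ge0 // -?deltaE ltW.
  have : (U * V) ^+ 2 * V ^+ 4 / A ^+ 8 <= 1.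
    rewrite ler_pdivrMr ?exprn_gt0 // mul1r.
    rewrite (_ : A ^+ 8 = (A ^+ 2) ^+ 2 * A ^+ 4); last by ring.
    rewrite ler_pM ?exprn_ge0 ?ler_pXn2r ?nnegrE ?mulr_ge0 ?exprn_ge0 //; try lra.
    by rewrite UVE; have := exprn_gt0 2 B0; lra.
  lra.
pose c := 9 / 2 + 18 * kap.
(* The slope 18 is less than 243/4, the slope at 0 of the convex function [9 / (2 - 27 kap)]. This
   also makes the final bound strict. *)
have c_lt : c < 9 / (2 - 27 * kap).
  rewrite ltr_pdivlMr; last lra.
  rewrite /c; have := exprn_gt0 2 kap0; nra.
have c0 : 0 < c by rewrite /c; lra.
have x1_le : x1 <= V ^+ 2 + c * L.
  apply: (least_root_laguerre_le x1P UV U2V2 alpha_gt); first exact: mulr_gt0.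
  rewrite -/m [V ^+ 4](_ : _ = (V ^+ 2) ^+ 2); last by rewrite -exprM.
  apply: (@scale_cube _ _ _ _ _ e h) => //.
  - by rewrite L3; field; rewrite gt_eqF.
  - by rewrite /e divfK ?gt_eqF.
  - by rewrite /h divfK ?gt_eqF.
  - by apply: (@small_parameter_ineq _ kap); rewrite ?e0 ?h0.
apply: (le_lt_trans x1_le); rewrite ltrD2l.
have -> : 9 * V `^ (4 / 3) / (m `^ (1 / 3) * (2 - 27 * kap)) = 9 / (2 - 27 * kap) * L.
  by rewrite /L; field; rewrite gt_eqF ?powR_gt0 //=; rewrite gt_eqF //; lra.
by rewrite ltr_pM2r.
Qed.

Lemma largest_root_laguerre_gt (R : realType) (k : nat) (alpha xk c A B : R) :
  0 < B -> B < A -> B ^+ 2 = k%:R -> A ^+ 2 = k%:R + alpha + 1 ->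
  let V := A - B in let U := A + B in
  largest_root (laguerre k alpha) xk -> (30 <= k)%N -> 9 / 2 <= c ->
  U ^+ 2 - c * (U `^ (4 / 3) / (U ^+ 2 - V ^+ 2) `^ (1 / 3)) < xk.
Proof.
move=> B0 BA B2 A2 V U xkP k30 hc; have A0 : 0 < A by lra.
have UVE : U * V = A ^+ 2 - B ^+ 2 by rewrite /U /V; ring.
have UV : U * V = alpha + 1 by rewrite UVE A2 B2; ring.
have U2V2 : U ^+ 2 + V ^+ 2 = 4 * k%:R + 2 * (alpha + 1).
  rewrite (_ : _ + _ = 2 * (A ^+ 2 + B ^+ 2)); last by rewrite /U /V; ring.
  by rewrite A2 B2; ring.
have alpha_gt : -1 < alpha.
  have : B ^+ 2 < A ^+ 2 by rewrite ltr_pXn2r ?nnegrE //; lra.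
  by rewrite A2 B2; lra.
have U0 : 0 < U by rewrite addr_gt0.
have UA : U <= 2 * A by rewrite /U; lra.
have W0 : 0 < U ^+ 2 by rewrite exprn_gt0.
set m := U ^+ 2 - V ^+ 2; have mE : m = 4 * A * B by rewrite /m /U /V; ring.
have m0 : 0 < m by rewrite mE !mulr_gt0.
have mU : m <= U ^+ 2 by rewrite /m gerBl sqr_ge0.
set L := U `^ (4 / 3) / m `^ (1 / 3).
have L0 : 0 < L by rewrite divr_gt0 ?powR_gt0.
have L3 : L ^+ 3 = U ^+ 4 / m by exact: powR_ratio_cube.
pose h := L / m.
have h0 : 0 <= h by rewrite divr_ge0 ?ltW.
have Lh : L = h * m by rewrite /h divfK ?gt_eqF.
(* From [U <= 2 A] and [k >= 30], [h^3 <= 1 / (16 k^2) <= 1/14400], and 0.0412 is slightly above the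
   cube root of 1/14400. *)
have h_le : h <= 412 / 10000.
  apply: ler_cube => //; first lra.
  have -> : h ^+ 3 = (U ^+ 4 / (2 * A) ^+ 4) / 16 / (B ^+ 2) ^+ 2.
    rewrite /h expr_div_n L3 mE; field; rewrite !gt_eqF //.
  have r1 : U ^+ 4 / (2 * A) ^+ 4 <= 1.
    by rewrite ler_pdivrMr ?exprn_gt0 ?mulr_gt0 // mul1r ler_pXn2r ?nnegrE //; lra.
  have B30 : 900 <= (B ^+ 2) ^+ 2.
    have : (30 : R) <= k%:R by rewrite ler_nat.
    by rewrite B2; nra.
  rewrite ler_pdivrMr; lra.
(* A constant slightly below 9/2 yields the strict inequality, and
   [(449/100)^3 / 80 - (449/100)^4 h / 140] still exceeds 1 for [h <= 0.0412]. *)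
have : U ^+ 2 - 449 / 100 * L <= xk.
  apply: (largest_root_laguerre_ge xkP UV U2V2 alpha_gt).
  - by rewrite pmulr_lgt0 //; lra.
  - by rewrite Lh; nra.
  - rewrite -/m [U ^+ 4](_ : _ = (U ^+ 2) ^+ 2); last by rewrite -exprM.
    have -> : m * (449 / 100 * L) ^+ 3 / 80 - (449 / 100 * L) ^+ 4 / 140
       = (U ^+ 2) ^+ 2 * ((449 / 100) ^+ 3 / 80 - (449 / 100) ^+ 4 * h / 140).
      rewrite (_ : (U ^+ 2) ^+ 2 = m * L ^+ 3); last first.
        by rewrite L3; field; rewrite gt_eqF.
      have L4 : L ^+ 4 = h * m * L ^+ 3 by rewrite exprS {1}Lh.
      by rewrite [(_ * L) ^+ 4]exprMn L4; field.
    by rewrite ltr_pMr ?exprn_gt0 //; lra.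
have : 9 / 2 * L <= c * L by rewrite ler_pM2r.
lra.
Qed.

Theorem theorem3 (R : realType) (k : nat) (alpha x1 xk : R)
    (hk : (1 <= k)%N) (halpha : -1 < alpha)
    (hx1 : least_root (laguerre k alpha) x1)
    (hxk : largest_root (laguerre k alpha) xk) :
  let V : R := Num.sqrt (k%:R + alpha + 1) - Num.sqrt k%:R in
  let U : R := Num.sqrt (k%:R + alpha + 1) + Num.sqrt k%:R in
  (let delta : R := k%:R^-1 + (alpha + 1)^-1 in
   delta < 1 / 50 ->
   x1 < V ^+ 2 + 9 * V `^ (4 / 3) /
          ((U ^+ 2 - V ^+ 2) `^ (1 / 3) * (2 - 27 * delta `^ (2 / 3))))
  /\
  ((30 <= k)%N ->
   (alpha <= 2 * (3 + 2 * Num.sqrt 3) * k%:R - 1 ->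
    xk > U ^+ 2 - 9 * U `^ (4 / 3) / (2 * (U ^+ 2 - V ^+ 2) `^ (1 / 3)))
   /\
   (alpha > 2 * (3 + 2 * Num.sqrt 3) * k%:R - 1 ->
    xk > U ^+ 2 - 9 * U `^ (4 / 3) /
           ((U ^+ 2 - V ^+ 2) `^ (1 / 3) * (2 - 3 * k%:R `^ (- (2 / 3)))))).
Proof.
have kR : 1 <= k%:R :> R by rewrite ler1n.
have B0 : 0 < Num.sqrt k%:R :> R by rewrite sqrtr_gt0; lra.
have BA : Num.sqrt k%:R < Num.sqrt (k%:R + alpha + 1) by rewrite ltr_sqrt; lra.
have B2 : Num.sqrt k%:R ^+ 2 = k%:R :> R by rewrite sqr_sqrtr.
have A2 : Num.sqrt (k%:R + alpha + 1) ^+ 2 = k%:R + alpha + 1.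
  by rewrite sqr_sqrtr; lra.
move=> V U; split=> [delta|k30]; first exact: least_root_laguerre_lt.
set kap := k%:R `^ _.
have main c := @largest_root_laguerre_gt _ _ _ _ c _ _ B0 BA B2 A2 hxk k30.
split=> _.
  have -> : 9 * U `^ (4 / 3) / (2 * (U ^+ 2 - V ^+ 2) `^ (1 / 3))
      = 9 / 2 * (U `^ (4 / 3) / (U ^+ 2 - V ^+ 2) `^ (1 / 3)).
    by rewrite [2 * _]mulrC invfM; ring.
  exact: main.
have -> : 9 * U `^ (4 / 3) / ((U ^+ 2 - V ^+ 2) `^ (1 / 3) * (2 - 3 * kap))
    = 9 / (2 - 3 * kap) * (U `^ (4 / 3) / (U ^+ 2 - V ^+ 2) `^ (1 / 3)).
  by rewrite invfM; ring.
(* It remains to see [9 / (2 - 3 kap) >= 9/2]. This holds as [0 < kap < 1/2], the upper bound coming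
   from [kap^3 = k^(-2) <= 1/900]. *)
apply: main.
have k30R : (30 : R) <= k%:R by rewrite ler_nat.
have kap0 : 0 < kap by rewrite powR_gt0; lra.
have kap_lt : kap < 1 / 2.
  rewrite ltNge; apply/negP => /(lerXn2r 3).
  rewrite !nnegrE => /(_ ltac:(lra) (ltW kap0)).
  rewrite -[_ ^+ 3 in X in _ <= X](_ : (k%:R ^+ 2)^-1 = _).
    rewrite -[leRHS]div1r ler_pdivlMr; nra.
  by rewrite /kap -mulNr powR_cube ?powR_invn //; lra.
rewrite ler_pdivlMr; lra.
Qed.
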